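(* For every integer $i\geq0$, $$\mathcal S_i^{(1)}=\mathcal S_{\le i}\cdot S_i(q-1)$$ in $A\otimes_{\mathbb F_q}K$; explicitly, $\sum_{a\in A_{+,i}}a\otimes a^{-q}=\Big(\sum_{\ell=0}^{i}\sum_{b\in A_{+,\ell}}b\otimes b^{-1}\Big)\cdot\Big(1\otimes\sum_{a\in A_{+,i}}a^{-(q-1)}\Big)$.
   Context: Let $\mathbb F_q$ be a finite field with $q$ elements, $X$ a geometrically connected smooth projective curve over $\mathbb F_q$ with function field $K$, and $\infty$ an $\mathbb F_q$-rational point. Let $A$ be the ring of elements of $K$ regular outside $\infty$, $\deg:=-v_\infty$ with $v_\infty$ the normalized valuation at $\infty$, $K_\infty=\mathbb F_q((\pi))$ the completion with a fixed uniformizer $\pi$. The sign $\mathrm{sgn}:K_\infty^\times\to\mathbb F_q^\times$ is the leading coefficient of the $\pi$-expansion; $A_{+,d}$ is the set of $a\in A$ with $\mathrm{sgn}(a)=1$ and $\deg a=d$ (empty sums are $0$). For $d\ge0$: $\mathcal S_d:=\sum_{a\in A_{+,d}}a\otimes a^{-1}\in A\otimes_{\mathbb F_q}K$, $\mathcal S_{\le d}:=\sum_{\ell=0}^{d}\mathcal S_\ell$, $S_d(n):=\sum_{a\in A_{+,d}}a^{-n}\in K$ (identified with $1\otimes S_d(n)$). The twist $f\mapsto f^{(1)}$ is the $A\otimes1$-linear map with $(a\otimes c)^{(1)}=a\otimes c^q$. *)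

(* Defs.v *)
From HB Require Import structures.
From mathcomp Require Import all_boot all_order all_algebra all_field.
From mathcomp Require Import boolp classical_sets cardinality fsbigop.

Set Implicit Arguments.
Unset Strict Implicit.
Unset Printing Implicit Defensive.

Import Order.TTheory GRing.Theory Num.Theory.

Local Open Scope classical_set_scope.
Local Open Scope ring_scope.
Local Open Scope quotient_scope.

(** A commutative [k]-algebra is given by its structure morphism out of [k].
    [tensor f g] is the quotient of the formal sums of pairs [(b, c)] (encoded
    as lists) by the congruence generated by the bilinearity relations. *)

Section Tensor.
Variables (k B C : comPzRingType).
Variables (f : {rmorphism k -> B}) (g : {rmorphism k -> C}).

Inductive tensor_eq : seq (B * C) -> seq (B * C) -> Prop :=
| tensor_eq_sym s t : tensor_eq s t -> tensor_eq t s
| tensor_eq_trans s t u : tensor_eq s t -> tensor_eq t u -> tensor_eq s u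
| tensor_eq_perm s t : perm_eq s t -> tensor_eq s t
| tensor_eq_catl s t u : tensor_eq s t -> tensor_eq (s ++ u) (t ++ u)
| tensor_eq_addl b b' c : tensor_eq [:: (b + b', c)] [:: (b, c); (b', c)]
| tensor_eq_addr b c c' : tensor_eq [:: (b, c + c')] [:: (b, c); (b, c')]
| tensor_eq_0 c : tensor_eq [:: (0, c)] [::]
| tensor_eq_scale x b c : tensor_eq [:: (f x * b, c)] [:: (b, g x * c)].

Definition tensor_eqb : rel (seq (B * C)) := fun s t => `[< tensor_eq s t >].

Fact tensor_eqb_refl : reflexive tensor_eqb.
Proof. by move=> s; apply/asboolP/tensor_eq_perm. Qed.

Fact tensor_eqb_sym : symmetric tensor_eqb.
Proof. by move=> s t; apply/asboolP/asboolP => /tensor_eq_sym. Qed.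

Fact tensor_eqb_trans : transitive tensor_eqb.
Proof.
move=> t s u /asboolP st /asboolP tu; apply/asboolP.
exact: tensor_eq_trans st tu.
Qed.

Canonical tensor_equiv :=
  EquivRel tensor_eqb tensor_eqb_refl tensor_eqb_sym tensor_eqb_trans.

Definition tensor := {eq_quot tensor_equiv}.
HB.instance Definition _ := Choice.on tensor.
HB.instance Definition _ := EqQuotient.on tensor.

Lemma tensor_pi_eq s t : tensor_eq s t -> \pi_tensor s = \pi_tensor t.
Proof. by move=> st; apply/eqmodP/asboolP. Qed.

Lemma tensor_pi_eqE s t : \pi_tensor s = \pi_tensor t -> tensor_eq s t.
Proof. by move/eqmodP/asboolP. Qed.

Lemma tensorW (P : tensor -> Prop) :
  (forall s, P (\pi_tensor s)) -> forall x, P x.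
Proof. by move=> Ps x; rewrite -[x]reprK; apply: Ps. Qed.

Lemma tensor_repr s : tensor_eq (repr (\pi_tensor s)) s.
Proof. by apply: tensor_pi_eqE; rewrite reprK. Qed.

Lemma tensor_eq_cat s s' t t' :
  tensor_eq s s' -> tensor_eq t t' -> tensor_eq (s ++ t) (s' ++ t').
Proof.
move=> ss tt; apply: tensor_eq_trans (tensor_eq_catl t ss) _.
apply: (@tensor_eq_trans _ (t ++ s')).
  by apply: tensor_eq_perm; rewrite perm_catC.
apply: tensor_eq_trans (tensor_eq_catl s' tt) _.
by apply: tensor_eq_perm; rewrite perm_catC.
Qed.

Definition tensor_zero : tensor := \pi_tensor [::].
Definition tensor_add (x y : tensor) : tensor := \pi_tensor (repr x ++ repr y).
Definition formal_opp (s : seq (B * C)) := [seq (- p.1, p.2) | p <- s].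
Definition tensor_opp (x : tensor) : tensor := \pi_tensor (formal_opp (repr x)).

Lemma tensor_add_pi s t :
  tensor_add (\pi_tensor s) (\pi_tensor t) = \pi_tensor (s ++ t).
Proof. by apply: tensor_pi_eq; apply: tensor_eq_cat; apply: tensor_repr. Qed.

Fact tensor_addA : associative tensor_add.
Proof.
move=> x y z; elim/tensorW: x => s; elim/tensorW: y => t; elim/tensorW: z => u.
by rewrite !tensor_add_pi catA.
Qed.

Fact tensor_addC : commutative tensor_add.
Proof.
move=> x y; elim/tensorW: x => s; elim/tensorW: y => t; rewrite !tensor_add_pi.
by apply: tensor_pi_eq; apply: tensor_eq_perm; rewrite perm_catC.
Qed.

Fact tensor_add0 : left_id tensor_zero tensor_add.
Proof. by move=> x; elim/tensorW: x => s; rewrite tensor_add_pi. Qed.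

Fact tensor_addN : left_inverse tensor_zero tensor_opp tensor_add.
Proof.
move=> x; rewrite /tensor_opp -{2}[x]reprK tensor_add_pi.
apply: tensor_pi_eq; elim: (repr x) => [|[b c] s IHs] /=.
  exact: tensor_eq_perm.
apply: (@tensor_eq_trans _ ([:: (- b, c); (b, c)] ++ (formal_opp s ++ s))).
  apply: tensor_eq_perm; rewrite /= perm_cons.
  by rewrite -cat_rcons -cat1s catA perm_cat2r perm_rcons perm_refl.
rewrite -[X in tensor_eq _ X]cat0s; apply: tensor_eq_cat => //.
apply: tensor_eq_trans (tensor_eq_sym (tensor_eq_addl _ _ _)) _.
by rewrite addNr; apply: tensor_eq_0.
Qed.

HB.instance Definition _ := GRing.isZmodule.Build tensor
  tensor_addA tensor_addC tensor_add0 tensor_addN.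

Definition tens (b : B) (c : C) : tensor := \pi_tensor [:: (b, c)].

Lemma tensDl b b' c : tens (b + b') c = tens b c + tens b' c.
Proof.
by rewrite /tens [RHS]tensor_add_pi; apply/tensor_pi_eq/tensor_eq_addl.
Qed.

Lemma tensDr b c c' : tens b (c + c') = tens b c + tens b c'.
Proof.
by rewrite /tens [RHS]tensor_add_pi; apply/tensor_pi_eq/tensor_eq_addr.
Qed.

Lemma tensZ x b c : tens (f x * b) c = tens b (g x * c).
Proof. exact/tensor_pi_eq/tensor_eq_scale. Qed.

Lemma tensor_piE s : \pi_tensor s = \sum_(p <- s) tens p.1 p.2.
Proof.
elim: s => [|[b c] s IHs]; first by rewrite big_nil.
by rewrite big_cons -IHs [RHS]tensor_add_pi.
Qed.

Lemma tensor_ind (P : tensor -> Prop) :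
  P 0 -> (forall x y, P x -> P y -> P (x + y)) ->
  (forall b c, P (tens b c)) -> forall x, P x.
Proof.
move=> P0 PD Pt; elim/tensorW=> s; rewrite tensor_piE.
by elim/big_ind: _.
Qed.

Record balanced (V : zmodType) (h : B -> C -> V) : Prop := Balanced {
  balancedDl : forall b b' c, h (b + b') c = h b c + h b' c;
  balancedDr : forall b c c', h b (c + c') = h b c + h b c';
  balancedZ : forall x b c, h (f x * b) c = h b (g x * c) }.

(** The additive map induced by a balanced biadditive map; this is only
    meaningful when [h] is [balanced]. *)
Definition tensor_lift (V : zmodType) (h : B -> C -> V) (x : tensor) : V :=
  \sum_(p <- repr x) h p.1 p.2.

Lemma tensor_eq_lift (V : zmodType) (h : B -> C -> V) s t :
  balanced h -> tensor_eq s t ->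
  \sum_(p <- s) h p.1 p.2 = \sum_(p <- t) h p.1 p.2.
Proof.
move=> [hDl hDr hZ]; elim=> {s t}.
- by move=> s t _ ->.
- by move=> s t u _ -> _ ->.
- by move=> s t st; apply: perm_big.
- by move=> s t u _ IH; rewrite !big_cat /= IH.
- by move=> b b' c; rewrite !big_cons !big_nil /= hDl !addr0.
- by move=> b c c'; rewrite !big_cons !big_nil /= hDr !addr0.
- move=> c; rewrite big_seq1 big_nil /=.
  by apply: (addrI (h 0 c)); rewrite addr0 -hDl addr0.
- by move=> x b c; rewrite !big_seq1 /= hZ.
Qed.

Lemma tensor_lift_pi (V : zmodType) (h : B -> C -> V) s :
  balanced h -> tensor_lift h (\pi_tensor s) = \sum_(p <- s) h p.1 p.2.
Proof. by move=> hb; apply: tensor_eq_lift => //; apply: tensor_repr. Qed.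

Lemma tensor_lift_tens (V : zmodType) (h : B -> C -> V) b c :
  balanced h -> tensor_lift h (tens b c) = h b c.
Proof. by move=> hb; rewrite tensor_lift_pi // big_seq1. Qed.

Lemma tensor_liftD (V : zmodType) (h : B -> C -> V) x y :
  balanced h -> tensor_lift h (x + y) = tensor_lift h x + tensor_lift h y.
Proof.
move=> hb; elim/tensorW: x => s; elim/tensorW: y => t.
by rewrite [_ + _]tensor_add_pi !tensor_lift_pi // big_cat.
Qed.

Lemma tensor_lift0 (V : zmodType) (h : B -> C -> V) :
  balanced h -> tensor_lift h 0 = 0.
Proof.
by move=> hb; rewrite -[0]/(\pi_tensor [::]) tensor_lift_pi // big_nil.
Qed.

Definition tensor_one : tensor := tens 1 1.

(** Determined by [(b (x) c) * (b' (x) c') = b b' (x) c c']: see [tensM]. *)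
Definition tensor_mul (x y : tensor) : tensor :=
  tensor_lift
    (fun b c => tensor_lift (fun b' c' => tens (b * b') (c * c')) y) x.

Fact balanced_mul_in b c : balanced (fun b' c' => tens (b * b') (c * c')).
Proof.
split=> [b1 b2 c1|b1 c1 c2|x b1 c1].
- by rewrite mulrDr tensDl.
- by rewrite mulrDr tensDr.
- by rewrite mulrCA tensZ mulrCA.
Qed.

Fact balanced_mul_out y :
  balanced (fun b c => tensor_lift (fun b' c' => tens (b * b') (c * c')) y).
Proof.
split=> [b1 b2 c1|b1 c1 c2|x b1 c1]; rewrite /tensor_lift -?big_split /=;
  apply: eq_bigr => p _.
- by rewrite mulrDl tensDl.
- by rewrite mulrDl tensDr.
- by rewrite -!mulrA tensZ.
Qed.

Lemma tensor_mul_tens b c b' c' :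
  tensor_mul (tens b c) (tens b' c') = tens (b * b') (c * c').
Proof.
rewrite /tensor_mul tensor_lift_tens; last exact: balanced_mul_out.
by rewrite tensor_lift_tens //; apply: balanced_mul_in.
Qed.

Fact tensor_mulDl : left_distributive tensor_mul +%R.
Proof. by move=> x y z; apply: tensor_liftD; apply: balanced_mul_out. Qed.

Fact tensor_mul0l x : tensor_mul 0 x = 0.
Proof. by apply: tensor_lift0; apply: balanced_mul_out. Qed.

Fact tensor_mulDr : right_distributive tensor_mul +%R.
Proof.
move=> x y z; rewrite /tensor_mul {1 3 5}/tensor_lift -big_split /=.
apply: eq_bigr => p _; rewrite tensor_liftD //; exact: balanced_mul_in.
Qed.

Fact tensor_mul0r x : tensor_mul x 0 = 0.
Proof.
rewrite /tensor_mul {1}/tensor_lift big1 // => p _; rewrite tensor_lift0 //.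
exact: balanced_mul_in.
Qed.

Fact tensor_mulC : commutative tensor_mul.
Proof.
move=> x y; elim/tensor_ind: x => [|x x' IH IH'|b c].
- by rewrite tensor_mul0l tensor_mul0r.
- by rewrite tensor_mulDl tensor_mulDr IH IH'.
elim/tensor_ind: y => [|y y' IH IH'|b' c'].
- by rewrite tensor_mul0l tensor_mul0r.
- by rewrite tensor_mulDl tensor_mulDr IH IH'.
by rewrite !tensor_mul_tens mulrC [c * _]mulrC.
Qed.

Fact tensor_mulA : associative tensor_mul.
Proof.
move=> x y z; elim/tensor_ind: x => [|x x' IH IH'|b c].
- by rewrite !tensor_mul0l.
- by rewrite !tensor_mulDl IH IH'.
elim/tensor_ind: y => [|y y' IH IH'|b' c'].
- by rewrite tensor_mul0l !tensor_mul0r tensor_mul0l.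
- by rewrite tensor_mulDl !tensor_mulDr tensor_mulDl IH IH'.
elim/tensor_ind: z => [|z z' IH IH'|b2 c2].
- by rewrite !tensor_mul0r.
- by rewrite !tensor_mulDr IH IH'.
by rewrite !tensor_mul_tens !mulrA.
Qed.

Fact tensor_mul1 : left_id tensor_one tensor_mul.
Proof.
move=> x; elim/tensor_ind: x => [|x x' IH IH'|b c].
- by rewrite tensor_mul0r.
- by rewrite tensor_mulDr IH IH'.
by rewrite tensor_mul_tens !mul1r.
Qed.

HB.instance Definition _ := GRing.Zmodule_isComPzRing.Build tensor
  tensor_mulA tensor_mulC tensor_mul1 tensor_mulDl.

Lemma tensM b c b' c' : tens b c * tens b' c' = tens (b * b') (c * c').
Proof. exact: tensor_mul_tens. Qed.

Lemma tens11 : tens 1 1 = 1.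
Proof. by []. Qed.

End Tensor.

(** A valuation is a function [v] into [int] whose value at [0] is irrelevant;
    [vge v m x] means [m <= v x] under the convention [v 0 = +oo]. *)

Section Valuation.
Variables (F : fieldType) (v : F -> int).

Definition vge (m : int) (x : F) : bool := (x == 0) || (m <= v x).

Record normalized_valuation : Prop := NormalizedValuation {
  valuationM : forall x y, x != 0 -> y != 0 -> v (x * y) = v x + v y;
  valuationD : forall x y, x != 0 -> y != 0 -> x + y != 0 ->
    Num.min (v x) (v y) <= v (x + y);
  valuation_surj : forall n : int, exists2 x, x != 0 & v x = n }.

Definition valuation_ring : set F := [set x | vge 0 x].

Definition vlim (u : nat -> F) (x : F) : Prop :=
  forall m : int, exists N : nat,
    forall n : nat, (N <= n)%N -> vge m (u n - x).

Definition vcauchy (u : nat -> F) : Prop :=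
  forall m : int, exists N : nat,
    forall n p : nat, (N <= n)%N -> (N <= p)%N -> vge m (u n - u p).

End Valuation.

(** [(L, w)] is the completion of [(F, v)] along the embedding [j]. *)
Record is_completion (F L : fieldType) (v : F -> int) (j : {rmorphism F -> L})
    (w : L -> int) : Prop := IsCompletion {
  completion_valuation : normalized_valuation w;
  completion_extends : forall x, x != 0 -> w (j x) = v x;
  completion_dense : forall (x : L) (m : int), exists y, vge w m (x - j y);
  completion_complete : forall u : nat -> L, vcauchy w u ->
    exists x, vlim w u x }.

Section FunctionField.
Variables (k K : fieldType) (iota : {rmorphism k -> K}).

(** The subfield [k(x)] of [K]. *)
Definition simple_ext (x : K) : set K :=
  [set z | exists p r : {poly k}, (map_poly iota r).[x] != 0 /\
    z = (map_poly iota p).[x] / (map_poly iota r).[x]].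

Definition is_function_field : Prop :=
  exists x : K, ~ algebraicOver iota x /\
    exists s : seq K, forall y : K, exists c : nat -> K,
      (forall n, simple_ext x (c n)) /\
      y = \sum_(n < size s) c n * s`_n.

(** The valuation rings of [K] over [k]; when [K] is a function field in one
    variable, they are exactly the local rings of the closed points of its
    smooth projective model. *)
Record is_place (O : set K) : Prop := IsPlace {
  place_const : forall c : k, O (iota c);
  place_sub : forall x y, O x -> O y -> O (x - y);
  place_mul : forall x y, O x -> O y -> O (x * y);
  place_proper : O <> setT;
  place_total : forall x, O x \/ O x^-1 }.

(** [v] is the normalized valuation at a [k]-rational point. *)
Record is_rational_point (v : K -> int) : Prop := IsRationalPoint {
  point_valuation : normalized_valuation v;
  point_const : forall c : k, c != 0 -> v (iota c) = 0;
  point_rational : forall x, vge v 0 x -> exists c : k, vge v 1 (x - iota c) }.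

Definition regular_outside (v : K -> int) : {pred K} :=
  fun x => `[< forall O, is_place O -> O <> valuation_ring v -> O x >].

Fact regular_outside_subring v : subring_closed (regular_outside v).
Proof.
split.
- by apply/asboolP => O OP _; rewrite -(rmorph1 iota); apply: place_const.
- move=> x y /asboolP xA /asboolP yA; apply/asboolP => O OP Ov.
  by apply: (place_sub OP); [apply: xA | apply: yA].
- move=> x y /asboolP xA /asboolP yA; apply/asboolP => O OP Ov.
  by apply: (place_mul OP); [apply: xA | apply: yA].
Qed.

HB.instance Definition _ v :=
  GRing.isSubringClosed.Build K (regular_outside v) (regular_outside_subring v).

Lemma regular_outside_const v (c : k) : iota c \in regular_outside v.
Proof. by apply/asboolP => O OP _; apply: place_const. Qed.

End FunctionField.

(** For every finite extension [k'] of [k], [Spec (K (x)_k k')] is connected.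
    If [X] is the smooth projective model of [K], then [X_k'] is normal with
    [K (x)_k k'] as its ring of rational functions, so this says that [X_k'] is
    connected. *)
Definition geometrically_connected (k : finFieldType) (K : fieldType)
    (iota : {rmorphism k -> K}) : Prop :=
  forall (k' : finFieldType) (h : {rmorphism k -> k'}) (e : tensor iota h),
    e * e = e -> e = 0 \/ e = 1.

(** A smooth projective curve is represented by its function field. *)
Record pointed_curve (k : finFieldType) := PointedCurve {
  funfield :> fieldType;
  const : {rmorphism k -> funfield};
  funfieldP : is_function_field const;
  funfield_connected : geometrically_connected const;
  vinf : funfield -> int;
  vinfP : is_rational_point const vinf;
  Kinf : fieldType;
  toKinf : {rmorphism funfield -> Kinf};
  winf : Kinf -> int;
  KinfP : is_completion vinf toKinf winf;
  unif : Kinf;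
  unifP : unif != 0 /\ winf unif = 1 }.

Arguments vinf {k} X _ : rename.
Arguments winf {k} X _ : rename.

Section Setting.
Variables (k : finFieldType) (X : pointed_curve k).
Local Notation K := (funfield X).
Local Notation q := #|k|.

Definition regfun := {a : K | a \in regular_outside (const X) (vinf X)}.
HB.instance Definition _ := SubChoice.on regfun.
HB.instance Definition _ :=
  [SubChoice_isSubComNzRing of regfun by <:].

Definition regfun_const (c : k) : regfun :=
  exist _ (const X c) (regular_outside_const (const X) (vinf X) c).

Fact regfun_const_zmod : zmod_morphism regfun_const.
Proof. by move=> c d; apply: val_inj; rewrite /= !rmorphB. Qed.

Fact regfun_const_monoid : monoid_morphism regfun_const.
Proof.
by split=> [|c d]; apply: val_inj; rewrite /= ?rmorph1 ?rmorphM.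
Qed.

HB.instance Definition _ :=
  GRing.isZmodMorphism.Build k regfun regfun_const regfun_const_zmod.
HB.instance Definition _ :=
  GRing.isMonoidMorphism.Build k regfun regfun_const regfun_const_monoid.

Definition deg (x : K) : int := - vinf X x.

(** [x = \sum_n c_n pi^(N + n)] in [Kinf], with [c_0 != 0]. *)
Definition is_expansion (x : Kinf X) (N : int) (c : nat -> k) : Prop :=
  c 0%N != 0 /\
  vlim (winf X)
    (fun m => \sum_(n < m) toKinf X (const X (c n)) * unif X ^ (N + n%:Z)) x.

(** The value [0] is taken only at [0], which has no expansion. *)
Definition sgn (x : Kinf X) : k :=
  xget 0 [set s | exists N c, is_expansion x N c /\ s = c 0%N].

Definition Aplus (d : nat) : set regfun :=
  [set a | sgn (toKinf X (val a)) = 1 /\ deg (val a) = d%:Z].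

Definition AtensK := tensor regfun_const (const X).
HB.instance Definition _ := GRing.ComPzRing.on AtensK.

Definition pure (a : regfun) (c : K) : AtensK := tens regfun_const (const X) a c.
Local Notation "a \ox c" := (pure a c) (at level 40, no associativity).

Definition calS (d : nat) : AtensK := \sum_(a \in Aplus d) a \ox (val a)^-1.

Definition calS_le (d : nat) : AtensK := \sum_(0 <= l < d.+1) calS l.

Definition powS (d n : nat) : K := \sum_(a \in Aplus d) (val a) ^- n.

(** The map [a (x) c |-> a (x) c^q]: see [twist_pure], [twistD] and [twistM]. *)
Definition twist (x : AtensK) : AtensK :=
  tensor_lift (fun a c => a \ox (c ^+ q)) x.

Lemma frobeniusD (x y : K) : (x + y) ^+ q = x ^+ q + y ^+ q.
Proof.
apply: exprDn_pchar; have [p p_pr pk] := finPcharP k.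
rewrite (eq_pnat _ (pcharf_eq (rmorph_pchar (const X) pk))).
by rewrite (card_pprimeChar pk) pnatX pnat_id.
Qed.

Lemma balanced_twist :
  balanced regfun_const (const X) (fun a c => a \ox (c ^+ q)).
Proof.
split=> [a b c|a c d|x a c].
- exact: tensDl.
- by rewrite frobeniusD; apply: tensDr.
- by rewrite exprMn -rmorphXn /= expf_card; apply: tensZ.
Qed.

Lemma twist_pure a c : twist (a \ox c) = a \ox (c ^+ q).
Proof. exact: tensor_lift_tens balanced_twist. Qed.

Lemma twistD x y : twist (x + y) = twist x + twist y.
Proof. exact: tensor_liftD balanced_twist. Qed.

Lemma twist0 : twist 0 = 0.
Proof. exact: tensor_lift0 balanced_twist. Qed.

Lemma twistM (a : regfun) x : twist ((a \ox 1) * x) = (a \ox 1) * twist x.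
Proof.
elim/tensor_ind: x => [|x y IHx IHy|b c].
- by rewrite mulr0 twist0 mulr0.
- by rewrite mulrDr !twistD IHx IHy mulrDr.
have pureM a1 c1 a2 c2 : (a1 \ox c1) * (a2 \ox c2) = (a1 * a2) \ox (c1 * c2).
  exact: tensM.
by rewrite pureM -/(b \ox c) !twist_pure pureM !mul1r.
Qed.

End Setting.

Arguments Aplus {k} X d _.

Notation "a \ox c" := (pure a c) (at level 40, no associativity) : ring_scope.

(* Main.v *)
From HB Require Import structures.
Require Import Defs.
From mathcomp Require Import all_boot all_order all_algebra all_field zify.
From mathcomp Require Import boolp classical_sets cardinality fsbigop.

Set Implicit Arguments.
Unset Strict Implicit.
Unset Printing Implicit Defensive.

Import Order.TTheory GRing.Theory Num.Theory.

Local Open Scope ring_scope.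

(** Suppose that [A_{+,i}] contains some [a0] and is finite. Then it is
    [a0 + W] for the finite [k]-space [W] of elements of degree [< i], and every
    nonzero element of [V = W + k a0] is a unique scalar multiple of a monic
    one, so that [S_{<= i} = - \sum_(v in V, v != 0) v (x) v^-1]. Let
    [m = \dim W]. Both sides of the identity lie in [V (x) K], where, by the
    nonvanishing of the Moore determinant, an element is determined by its
    images under [a (x) c |-> a ^+ (q ^ j) * c] for [j <= m]. For [j = 0] both
    images are [\sum_a a ^- (q - 1)]; for [j > 0] both vanish, because
    [\sum_(u in U) p.[u] = 0] for any finite additive group [U] and any
    polynomial [p] of degree less than [#|U| - 1].

    If [A_{+,i}] were infinite (which Riemann-Roch excludes), both sides would
    be [0] by the convention on sums with infinite support. *)

(** * Polynomials evaluated on finite sets and finite additive groups *)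

Lemma poly_eq0_on_codom (I : finType) (K : fieldType) (u : I -> K)
    (p : {poly K}) :
  injective u -> (size p <= #|I|)%N -> (forall i, p.[u i] = 0) -> p = 0.
Proof.
move=> u_inj size_p up0; apply: contraTeq size_p => p_neq0; rewrite -ltnNge.
rewrite -(size_codom u); apply: max_poly_roots p_neq0 _ _.
  by apply/allP => _ /codomP[i ->]; rewrite rootE up0.
by rewrite codomE map_inj_uniq ?enum_uniq.
Qed.

(* Lagrange interpolation on [codom u]: the derivative of [\prod_i ('X - u i)]
   takes the same value [c] at all nodes, by translation invariance. *)
Lemma sum_horner_additive_eq0 (I : finZmodType) (K : fieldType)
    (u : {additive I -> K}) (p : {poly K}) :
  injective u -> (size p < #|I|)%N -> \sum_i p.[u i] = 0.
Proof.
move=> u_inj size_p; have I_gt0 : (0 < #|I|)%N by rewrite (cardD1 0).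
pose e i : {poly K} := \prod_(w | w != i) ('X - (u w)%:P).
pose c := \prod_(w | w != 0) u w.
have size_e i : size (e i) = #|I|.
  rewrite /e -big_filter size_prod_XsubC -sum1_size big_filter sum1_card.
  by rewrite cardC1 prednK.
have e_diag i : (e i).[u i] = c.
  rewrite horner_prod /c (reindex_inj (subrI i)) /=.
  apply: eq_big => [w|w _].
    by rewrite /= -subr_eq0 addrAC subrr add0r oppr_eq0.
  by rewrite hornerXsubC raddfB opprB addrC subrK.
have e_off i j : j != i -> (e i).[u j] = 0.
  by move=> ji; rewrite horner_prod (bigD1 j) //= hornerXsubC subrr mul0r.
pose g := \sum_i p.[u i] *: e i - c *: p.
have g0 : g = 0.
  apply: (poly_eq0_on_codom u_inj) => [|j].
    rewrite (leq_trans (size_polyD _ _)) // geq_max size_polyN.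
    apply/andP; split.
      rewrite (leq_trans (size_sum _ _ _)) //; apply/bigmax_leqP => i _.
      by rewrite (leq_trans (size_scale_leq _ _)) ?size_e.
    exact: leq_trans (size_scale_leq _ _) (ltnW size_p).
  rewrite hornerD hornerN hornerZ horner_sum (bigD1 j) //= big1 => [|i ij].
    by rewrite hornerZ e_diag addr0 mulrC subrr.
  by rewrite hornerZ e_off ?mulr0 // eq_sym.
(* Compare coefficients of degree [#|I|.-1]: that of [p] is 0 and each [e i] is monic of this
   degree, so only [\sum_i p.[u i]] remains. *)
have /(congr1 (fun r : {poly K} => r`_#|I|.-1)) := g0.
rewrite coefB coefZ (nth_default 0 (s := p)); last by rewrite -ltnS prednK.
rewrite mulr0 subr0 coef0 coef_sum => sum0; rewrite -[RHS]sum0.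
apply: eq_bigr => i _.
have /monicP : e i \is monic by apply: monic_prod_XsubC.
by rewrite coefZ lead_coefE size_e => ->; rewrite mulr1.
Qed.

(** * Finite [k]-spans, the Moore matrix and the tensor identity *)

Section Combination.
Variables (k : finFieldType) (A : comPzRingType) (K : fieldType).
Variables (h : {rmorphism k -> A}) (f : {rmorphism A -> K}).
Local Notation q := #|k|.

(** Parametrizing a span by row vectors over [k] makes it a finite type that can be summed over;
    linear independence of [b] becomes injectivity of [comb b]. *)
Definition comb n (b : 'I_n -> A) (x : 'rV[k]_n) : A := \sum_i h (x 0 i) * b i.

Fact comb_zmod_morphism n (b : 'I_n -> A) : zmod_morphism (comb b).
Proof.
move=> x y; rewrite /comb -sumrB; apply: eq_bigr => i _.
by rewrite !mxE rmorphB mulrBl.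
Qed.
HB.instance Definition _ n (b : 'I_n -> A) :=
  GRing.isZmodMorphism.Build _ _ (comb b) (comb_zmod_morphism b).

Lemma combZ n (b : 'I_n -> A) c x : comb b (c *: x) = h c * comb b x.
Proof.
by rewrite /comb mulr_sumr; apply: eq_bigr => i _; rewrite mxE rmorphM mulrA.
Qed.

Lemma card_frobeniusD j (x y : K) :
  (x + y) ^+ (q ^ j) = x ^+ (q ^ j) + y ^+ (q ^ j).
Proof.
apply: exprDn_pchar; have [p p_pr pk] := finPcharP k.
rewrite (eq_pnat _ (pcharf_eq (rmorph_pchar (f \o h) pk))).
by rewrite (card_pprimeChar pk) !pnatX pnat_id.
Qed.

Lemma expf_card_pow j (x : k) : x ^+ (q ^ j) = x.
Proof. by elim: j => // j IHj; rewrite expnSr exprM IHj expf_card. Qed.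

Lemma comb_frobenius n (b : 'I_n -> A) j x :
  f (comb b x) ^+ (q ^ j) = \sum_i f (h (x 0 i)) * f (b i) ^+ (q ^ j).
Proof.
rewrite /comb rmorph_sum /=.
have frob_sum (F : 'I_n -> K) :
    (\sum_i F i) ^+ (q ^ j) = \sum_i F i ^+ (q ^ j).
  elim/big_rec2: _ => [|i y z _ <-]; last by rewrite card_frobeniusD.
  by rewrite expr0n eqn0Ngt expn_gt0 (cardD1 0).
rewrite frob_sum; apply: eq_bigr => i _.
by rewrite rmorphM exprMn -!rmorphXn /= expf_card_pow.
Qed.

(* The Moore determinant of a [k]-linearly independent family is nonzero: a
   vanishing combination of its rows is a polynomial of degree at most
   [q ^ n.-1] with [q ^ n] roots. *)
Lemma moore_unitmx n (b : 'I_n -> A) :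
  injective (f \o comb b) ->
  \matrix_(i < n, j < n) f (b i) ^+ (q ^ j) \in unitmx.
Proof.
move=> b_inj; set M := \matrix_(_, _) _; rewrite -unitmx_tr unitmxE unitfE.
apply/det0P => -[d /eqP d_neq0 dM]; apply: d_neq0; apply/rowP => j; rewrite mxE.
have q_gt1 : (1 < q)%N := finRing_gt1 k.
pose p : {poly K} := \sum_j d 0 j *: 'X^(q ^ j).
have p0 : p = 0.
  apply: (poly_eq0_on_codom b_inj) => [|x].
    rewrite card_mx mul1n (leq_trans (size_sum _ _ _)) //.
    apply/bigmax_leqP => i _; rewrite (leq_trans (size_scale_leq _ _)) //.
    by rewrite size_polyXn ltn_exp2l.
  rewrite horner_sum; transitivity
    (\sum_(i < n) f (h (x 0 i)) * \sum_j d 0 j * f (b i) ^+ (q ^ j)).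
    under [RHS]eq_bigr do rewrite mulr_sumr.
    rewrite exchange_big; apply: eq_bigr => l _ /=.
    rewrite hornerZ hornerXn comb_frobenius mulr_sumr.
    by apply: eq_bigr => i _; rewrite mulrCA.
  apply: big1 => i _; have /rowP/(_ i) := dM; rewrite !mxE => dM0.
  suff ->: \sum_j d 0 j * f (b i) ^+ (q ^ j) = 0 by rewrite mulr0.
  rewrite -[RHS]dM0.
  by apply: eq_bigr => l _; rewrite !mxE.
have /(congr1 (fun r : {poly K} => r`_(q ^ j))) := p0.
rewrite coef0 coef_sum (bigD1 j) //= big1 => [|i ij].
  by rewrite coefZ coefXn eqxx mulr1 addr0.
by rewrite coefZ coefXn eqn_exp2l // eq_sym [_ == _](negPf ij) mulr0.
Qed.

Variable g : {rmorphism k -> K}.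
Hypothesis fhE : forall c, f (h c) = g c.
Local Notation "a \oxt c" := (tens h g a c) (at level 40).

Lemma tens_suml (I : finType) (F : I -> A) c :
  (\sum_i F i) \oxt c = \sum_i F i \oxt c.
Proof.
apply: (big_morph (fun a => a \oxt c)) => [a a'|]; first exact: tensDl.
by apply: (addrI (0 \oxt c)); rewrite -tensDl !addr0.
Qed.

Lemma tensr0 a : a \oxt 0 = 0.
Proof. by apply: (addrI (a \oxt 0)); rewrite -tensDr !addr0. Qed.

Lemma tens_sumr (I : finType) a (F : I -> K) :
  a \oxt (\sum_i F i) = \sum_i a \oxt F i.
Proof.
apply: (big_morph (fun c => a \oxt c)) => [c c'|]; first exact: tensDr.
exact: tensr0.
Qed.

(** Scalars of [k] pass across the tensor sign, so such a sum is given by one coordinate in [K] for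
    each [b j]. *)
Lemma tens_comb (I : finType) n (b : 'I_n -> A)
    (x : I -> 'rV[k]_n) (y : I -> K) :
  \sum_i comb b (x i) \oxt y i = \sum_j b j \oxt \sum_i f (h (x i 0 j)) * y i.
Proof.
under eq_bigr do rewrite /comb tens_suml.
rewrite exchange_big; apply: eq_bigr => j _ /=; rewrite tens_sumr.
by apply: eq_bigr => i _; rewrite tensZ fhE.
Qed.

(* The maps [a (x) c |-> f a ^+ (q ^ j) * c], [j < n], are jointly injective on
   the [K]-span of an independent family of size [n], by [moore_unitmx]. *)
Lemma tens_comb_eq (I J : finType) n (b : 'I_n -> A)
    (x : I -> 'rV[k]_n) (y : I -> K) (x' : J -> 'rV[k]_n) (y' : J -> K) :
  injective (f \o comb b) ->
  (forall j : nat, (j < n)%N -> \sum_i f (comb b (x i)) ^+ (q ^ j) * y i =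
                     \sum_i f (comb b (x' i)) ^+ (q ^ j) * y' i) ->
  \sum_i comb b (x i) \oxt y i = \sum_i comb b (x' i) \oxt y' i.
Proof.
move=> b_inj ev_eq; rewrite !tens_comb.
pose coords (I0 : finType) (x0 : I0 -> 'rV[k]_n) (y0 : I0 -> K) : 'rV[K]_n :=
  \row_i \sum_t f (h (x0 t 0 i)) * y0 t.
suff /rowP eq_xy : coords _ x y = coords _ x' y'.
  by apply: eq_bigr => i _; have := eq_xy i; rewrite !mxE => ->.
(* The [j]-th evaluation is the [j]-th entry of the coordinate row times the Moore matrix, which is
   invertible. *)
apply: (can_inj (mulmxK (moore_unitmx b_inj))); apply/rowP => j.
have coordsE (I0 : finType) (x0 : I0 -> 'rV[k]_n) y0 : (coords _ x0 y0 *m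
    \matrix_(i < n, j < n) f (b i) ^+ (q ^ j)) 0 j =
    \sum_t f (comb b (x0 t)) ^+ (q ^ j) * y0 t.
  rewrite mxE; under eq_bigr do rewrite !mxE mulr_suml.
  rewrite exchange_big; apply: eq_bigr => t _ /=.
  rewrite comb_frobenius mulr_suml; apply: eq_bigr => i _.
  by rewrite mulrAC.
by rewrite !coordsE ev_eq.
Qed.

Definition fcons n (a : A) (b : 'I_n -> A) (i : 'I_n.+1) : A :=
  oapp b a (unlift ord0 i).

Definition row_cons n (c : k) (x : 'rV[k]_n) : 'rV[k]_n.+1 :=
  \row_i oapp (x 0) c (unlift ord0 i).

Lemma comb_fcons n a (b : 'I_n -> A) c (x : 'rV[k]_n) :
  comb (fcons a b) (row_cons c x) = h c * a + comb b x.
Proof.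
rewrite /comb big_ord_recl /fcons mxE unlift_none /=; congr (_ + _).
by apply: eq_bigr => i _; rewrite mxE liftK.
Qed.

Lemma row_consK n (x : 'rV[k]_n.+1) :
  x = row_cons (x 0 0) (\row_i x 0 (lift ord0 i)).
Proof.
by apply/rowP => i; rewrite mxE; case: unliftP => [j|] -> //=; rewrite mxE.
Qed.

Lemma row_cons_inj n c : injective (@row_cons n c).
Proof.
move=> x y /rowP xy; apply/rowP => i; have := xy (lift ord0 i).
by rewrite !mxE liftK.
Qed.

Lemma natr_card_pow n : (0 < n)%N -> (q ^ n)%:R = 0 :> K.
Proof.
move=> n_gt0; have [p p_pr pk] := finPcharP k; apply/eqP.
rewrite -(dvdn_pcharf (rmorph_pchar (f \o h) pk)) dvdn_exp //.
have [d qE] : exists d, q = (p ^ d)%N by eexists; apply: card_pprimeChar pk.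
by have := finRing_gt1 k; rewrite qE; case: d {qE} => // d _; rewrite dvdn_exp.
Qed.

(** This is [sum_horner_additive_eq0] for the polynomial [('X + y) ^ e], of size [e.+1], on a group
    of order [q ^ n]. A nonzero [y] serves for sums over a coset. *)
Lemma sum_shift_expn_eq0 n (b : 'I_n -> A) y e :
  injective (f \o comb b) -> (e.+1 < q ^ n)%N ->
  \sum_x (y + f (comb b x)) ^+ e = 0.
Proof.
move=> b_inj e_lt.
have := @sum_horner_additive_eq0 _ _ (f \o comb b) (('X - (- y)%:P) ^+ e) b_inj.
rewrite card_mx mul1n size_exp_XsubC => /(_ e_lt) {2}<-.
by apply: eq_bigr => x _; rewrite horner_exp hornerXsubC opprK addrC.
Qed.

(* Both sides have the same image under [a (x) c |-> f a ^+ (q ^ j) * c] for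
   [j <= m]: it is [\sum_a f a ^- (q - 1)] for [j = 0] and [0] for [j > 0]. *)
Lemma moore_tensor_identity m a0 (b : 'I_m -> A) :
  injective (f \o comb (fcons a0 b)) ->
  \sum_x (a0 + comb b x) \oxt (f (a0 + comb b x) ^- q) =
  - ((\sum_x comb (fcons a0 b) x \oxt (f (comb (fcons a0 b) x))^-1) *
     (1 \oxt \sum_x f (a0 + comb b x) ^- (q - 1))).
Proof.
set be := fcons a0 b => be_inj; set N := \sum_x f (a0 + comb b x) ^- (q - 1).
have q_gt1 : (1 < q)%N := finRing_gt1 k.
have combE x : a0 + comb b x = comb be (row_cons 1 x).
  by rewrite comb_fcons rmorph1 mul1r.
have b_inj : injective (f \o comb b).
  move=> x y /= fxy; apply: (@row_cons_inj _ 1); apply: be_inj => /=.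
  by rewrite -!combE !rmorphD fxy.
have be0 x : f (comb be x) = 0 -> x = 0.
  by move=> fx0; apply: be_inj; rewrite /= fx0 !raddf0.
have fa_neq0 x : f (a0 + comb b x) != 0.
  rewrite combE; apply/eqP => /be0 /rowP/(_ 0) /eqP.
  by rewrite !mxE unlift_none /= oner_eq0.
rewrite mulr_suml -sumrN.
have tensN a c : - (a \oxt c) = a \oxt - c.
  by apply: (addrI (a \oxt c)); rewrite -tensDr !subrr tensr0.
under [RHS]eq_bigr do rewrite tensM mulr1 tensN.
under [LHS]eq_bigr do rewrite combE.
apply: tens_comb_eq => // j; rewrite ltnS => j_le.
have [->|j_gt0] := posnP j.
  rewrite expn0; transitivity N.
    apply: eq_bigr => x _; rewrite -combE expr1.
    rewrite -[in X in _ / X](subnK (ltnW q_gt1)) exprD expr1 invfM mulrC -mulrA.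
    by rewrite mulVf ?mulr1.
  (* The zero vector contributes 0. The other [q ^ m.+1 - 1] vectors contribute [- N] each, and
     their number is [-1] in [K]. *)
  rewrite (bigD1 0) //= !raddf0 mul0r add0r.
  rewrite (eq_bigr (fun=> - N)) => [|x x_neq0]; last first.
    rewrite mulrN mulrA mulfV ?mul1r //.
    by apply: contra x_neq0 => /eqP/be0 ->.
  rewrite sumr_const cardC1 card_mx mul1n -mulr_natl -subn1.
  rewrite natrB ?expn_gt0 ?(ltnW q_gt1) //.
  by rewrite natr_card_pow // sub0r mulrNN mul1r.
transitivity (0 : K); last symmetry.
  (* On the left the exponent is [q ^ j - q], over a coset of a group of order [q ^ m]; the bound
     holds because [q > 1] and [j <= m]. *)
  have q_le : (q <= q ^ j)%N by rewrite -{1}(expn1 q) leq_pexp2l // ltnW.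
  rewrite -{}[RHS](@sum_shift_expn_eq0 _ _ (f a0) (q ^ j - q) b_inj).
    apply: eq_bigr => x _; rewrite -rmorphD -combE.
    by rewrite -{1}(subnK q_le) exprD mulfK // expf_neq0.
  apply: (@leq_trans (q ^ j)); last by rewrite leq_exp2l.
  by rewrite -(ltn_add2r q) addSn subnK //; lia.
have qj_gt1 : (1 < q ^ j)%N by rewrite -(expn0 q) ltn_exp2l.
(* On the right the exponent is [q ^ j - 1], over a group of order [q ^ m.+1]. The zero vector fits
   the formula because this exponent is positive and [0^-1 = 0]. *)
rewrite (eq_bigr (fun x => f (comb be x) ^+ (q ^ j - 1) * - N)) => [|x _].
  rewrite -mulr_suml.
  under eq_bigr do rewrite -[f _]add0r.
  rewrite sum_shift_expn_eq0 ?mul0r // subn1 prednK ?ltn_exp2l //.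
  exact: ltnW.
rewrite mulrN mulrA; have [->|fx_neq0] := eqVneq (f (comb be x)) 0.
  by rewrite invr0 mulr0 mul0r oppr0 expr0n subn_eq0 leqNgt qj_gt1 mul0r.
by rewrite -{1}(subnK (ltnW qj_gt1)) exprD expr1 mulfK // mulrN.
Qed.

End Combination.

(** * Bases of finite [k]-spaces, monic representatives, and sums over finite spans *)

Section Basis.
Variables (k : finFieldType) (A : comPzRingType) (h : {rmorphism k -> A}).
Local Notation q := #|k|.
Local Notation comb := (comb h).

(** In a linear relation with nonzero coefficient at [a], dividing by that coefficient would put [a]
    in the span of [b]. *)
Lemma comb_fcons_inj n a (b : 'I_n -> A) :
  injective (comb b) -> (forall x, comb b x <> a) ->
  injective (comb (fcons a b)).
Proof.
move=> b_inj Na; apply: raddf_inj => x /=; rewrite [x]row_consK comb_fcons.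
set c := x 0 0; set x' := \row_i _ => cx0.
have c0 : c = 0.
  apply: contrapT => /eqP c_neq0; apply: (Na (- c^-1 *: x')).
  rewrite combZ; have -> : comb b x' = - (h c * a).
    by apply: (addrI (h c * a)); rewrite cx0 subrr.
  by rewrite mulrN rmorphN mulNr opprK mulrA -rmorphM mulVf // rmorph1 mul1r.
have -> : x' = 0.
  by apply: b_inj; rewrite raddf0 -cx0 c0 rmorph0 mul0r add0r.
rewrite c0; apply/rowP => i; rewrite !mxE.
by case: unliftP => //= l _; rewrite mxE.
Qed.

(** A longest independent family in [W] spans it, as a vector outside the span would extend it.
    Lengths are bounded because [n] independent vectors have [q ^ n > n] combinations in [W]. *)
Lemma finite_basis (W : set A) :
  finite_set W -> W 0 -> (forall c a b, W a -> W b -> W (h c * a + b)) ->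
  exists n (b : 'I_n -> A), injective (comb b) /\
    forall a, W a <-> exists x, comb b x = a.
Proof.
move=> /finite_seqP[s WE] W0 WZD.
pose P n := `[< exists b : 'I_n -> A,
  injective (comb b) /\ forall x, W (comb b x) >].
have exP : exists n, P n.
  exists 0%N; apply/asboolP; exists (fun=> 0); split=> [x y _|x].
    by rewrite [x]thinmx0 [y]thinmx0.
  by rewrite /comb big_ord0.
have ubP n : P n -> (n <= size s)%N.
  move=> /asboolP[b [b_inj Wb]].
  apply: leq_trans (ltnW (ltn_expl n (finRing_gt1 k))) _.
  have := card_mx k 1 n; rewrite mul1n => <-; rewrite -(size_codom (comb b)).
  apply: uniq_leq_size => [|_ /codomP[x ->]].
    by rewrite codomE map_inj_uniq ?enum_uniq.
  by have := Wb x; rewrite WE.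
case: (ex_maxnP exP ubP) => n /asboolP[b [b_inj Wb]] n_max.
exists n, b; split=> // a; split=> [Wa|[x <-]//]; apply: contrapT => Na.
suff /n_max : P n.+1 by rewrite ltnn.
apply/asboolP; exists (fcons a b); split=> [|x].
  by apply: comb_fcons_inj => // x xa; apply: Na; exists x.
by rewrite [x]row_consK comb_fcons; apply: WZD.
Qed.

(* Each orbit of [k^*] on the nonzero vectors has a unique element [x] with
   [sg x = 1]. *)
Lemma sum_monic n (sg : 'rV[k]_n -> k) (V : zmodType) (F : 'rV[k]_n -> V) :
  (forall c x, sg (c *: x) = c * sg x) -> (forall x, sg x = 0 -> x = 0) ->
  F 0 = 0 -> (forall c x, c != 0 -> F (c *: x) = F x) ->
  \sum_x F x = (\sum_(x | sg x == 1) F x) *+ q.-1.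
Proof.
move=> sgZ sg_eq0 F0 FZ; have sg0 : sg 0 = 0 by rewrite -(scale0r 0) sgZ mul0r.
rewrite (partition_big sg predT) //= (bigD1 0) //=.
rewrite big1 ?add0r => [|x /eqP/sg_eq0->//].
rewrite -[q.-1](cardC1 (0 : k)) -sumr_const; apply: eq_bigr => c c_neq0.
rewrite (reindex_inj (scalerI c_neq0)) /=.
apply: eq_big => [x|x _]; last exact: FZ.
by rewrite sgZ -{2}[c]mulr1 (inj_eq (mulfI c_neq0)).
Qed.

(** The multiplication map [a (x) c |-> f a * c] is balanced, so it is defined on the tensor product
    and detects nonzero pure tensors. *)
Lemma tens_eq0 (K : fieldType) (f : {rmorphism A -> K})
    (g : {rmorphism k -> K}) a c :
  (forall c, f (h c) = g c) -> tens h g a c = 0 -> f a * c = 0.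
Proof.
move=> fhE t0; have bal : balanced h g (fun a c => f a * c).
  split=> [x y z|x y z|x y z]; rewrite ?rmorphD ?mulrDl ?mulrDr //.
  by rewrite rmorphM mulrCA mulrA fhE.
by rewrite -(tensor_lift_tens a c bal) t0 tensor_lift0.
Qed.

(** This lets the multiplicity [q.-1] of [sum_monic] act as [-1]. *)
Lemma tensor_char (K : fieldType) (f : {rmorphism A -> K})
    (g : {rmorphism k -> K}) (t : tensor h g) : t *+ q = 0.
Proof.
elim/tensor_ind: t => [|x y xq yq|a c]; first by rewrite mul0rn.
  by rewrite mulrnDl xq yq addr0.
have -> : tens h g a c *+ q = tens h g a (c *+ q).
  by rewrite -!sumr_const tens_sumr.
have := natr_card_pow h f (ltn0Sn 0); rewrite expn1 => q0.
by rewrite -mulr_natr q0 mulr0 tensr0.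
Qed.

End Basis.

Lemma fsbig_inj_finType (I : finType) (T : choiceType) (V : zmodType)
    (u : I -> T) (D : set T) (F : T -> V) :
  injective u -> (forall a, D a -> exists x, u x = a) ->
  \sum_(a \in D) F a = \sum_(x | `[< D (u x) >]) F (u x).
Proof.
move=> u_inj Du; pose r := [seq u x | x <- enum I & `[< D (u x) >]].
rewrite (fsbigE r).
- rewrite big_map big_filter_cond big_enum_cond; apply: eq_bigl => x /=.
  by case: asboolP => //= Dx; apply/mem_set.
- by rewrite map_inj_uniq // filter_uniq // enum_uniq.
- by move=> a /mapP[x]; rewrite mem_filter => /andP[/asboolP Dx _] ->.
move=> a Da; have [x xa] := Du _ Da; case/negP; apply/mapP; exists x => //.
by rewrite mem_filter mem_enum andbT; apply/asboolP; rewrite xa.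
Qed.

(** * Elementary properties of normalized valuations *)

Section ValuationTheory.
Variables (F : fieldType) (v : F -> int).
Hypothesis v_val : normalized_valuation v.

Lemma vgeE m x : x != 0 -> vge v m x = (m <= v x).
Proof. by rewrite /vge => /negPf->. Qed.

Lemma vge0 m : vge v m 0.
Proof. by rewrite /vge eqxx. Qed.

Lemma vge_refl x : vge v (v x) x.
Proof. by rewrite /vge lexx orbT. Qed.

Lemma vge_le m n x : m <= n -> vge v n x -> vge v m x.
Proof.
move=> mn /orP[/eqP->|nx]; first by rewrite vge0.
by rewrite /vge (le_trans mn nx) orbT.
Qed.

Lemma valuation1 : v 1 = 0.
Proof.
have := valuationM v_val (oner_neq0 F) (oner_neq0 F); rewrite mulr1 => v1.
by apply: (addrI (v 1)); rewrite addr0 -v1.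
Qed.

Lemma valuationN x : v (- x) = v x.
Proof.
have [->|x_neq0] := eqVneq x 0; first by rewrite oppr0.
have N1_neq0 : (-1 : F) != 0 by rewrite oppr_eq0 oner_neq0.
have := valuationM v_val N1_neq0 N1_neq0; rewrite mulrNN mulr1 valuation1.
move=> vN1; rewrite -mulN1r (valuationM v_val) //; lia.
Qed.

Lemma valuationV x : x != 0 -> v x^-1 = - v x.
Proof.
move=> x_neq0; apply/eqP; rewrite -addr_eq0 -(valuationM v_val) ?invr_eq0 //.
by rewrite mulVf // valuation1.
Qed.

Lemma valuationX x n : x != 0 -> v (x ^+ n) = v x *+ n.
Proof.
move=> x_neq0; elim: n => [|n IHn]; first by rewrite expr0 valuation1.
by rewrite exprS (valuationM v_val) ?expf_neq0 // IHn mulrS.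
Qed.

Lemma valuationXz x (n : int) : x != 0 -> v (x ^ n) = v x * n.
Proof.
move=> x_neq0; case: n => n.
  by rewrite -exprnP valuationX // -mulr_natr natz.
rewrite NegzE -exprnN valuationV ?expf_neq0 // valuationX //.
by rewrite -mulr_natr natz mulrN.
Qed.

Lemma vgeN m x : vge v m (- x) = vge v m x.
Proof. by rewrite /vge oppr_eq0 valuationN. Qed.

Lemma vgeD m x y : vge v m x -> vge v m y -> vge v m (x + y).
Proof.
have [->|x_neq0] := eqVneq x 0; first by rewrite add0r.
have [->|y_neq0] := eqVneq y 0; first by rewrite addr0.
have [->|xy_neq0] := eqVneq (x + y) 0; first by rewrite vge0.
rewrite !vgeE // => mx my.
apply: le_trans (valuationD v_val x_neq0 y_neq0 xy_neq0).
by rewrite le_min mx.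
Qed.

Lemma vgeB m x y : vge v m x -> vge v m y -> vge v m (x - y).
Proof. by move=> mx my; rewrite vgeD ?vgeN. Qed.

Lemma vgeM m n x y : vge v m x -> vge v n y -> vge v (m + n) (x * y).
Proof.
have [->|x_neq0] := eqVneq x 0; first by rewrite mul0r !vge0.
have [->|y_neq0] := eqVneq y 0; first by rewrite mulr0 !vge0.
by rewrite !vgeE ?mulf_neq0 // (valuationM v_val) // => mx ny; rewrite lerD.
Qed.

(** Isosceles principle: a perturbation of higher valuation cannot change the valuation of [x]. *)
Lemma vge_valuation_eq m x y : x != 0 -> v x = m -> vge v (m + 1) (y - x) ->
  y != 0 /\ v y = m.
Proof.
move=> x_neq0 vx yx; have yE : y = y - x + x by rewrite subrK.
have my : vge v m y.
  rewrite yE; apply: vgeD; last by rewrite -vx vge_refl.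
  by apply: vge_le yx; rewrite lerDl.
have Nmy : ~~ vge v (m + 1) y.
  apply/negP => m1y; have : vge v (m + 1) x by rewrite -(subKr y x) vgeB.
  by rewrite vgeE // vx; lia.
have y_neq0 : y != 0 by apply: contraNneq Nmy => ->; apply: vge0.
split=> //; move: my Nmy; rewrite !vgeE //; lia.
Qed.

End ValuationTheory.

(** * Expansions in the uniformizer and the sign on [Kinf] *)

Section LeadingCoefficient.
Variables (k : finFieldType) (X : pointed_curve k).
Local Notation K := (funfield X).
Local Notation j := (toKinf X).
Local Notation v := (vinf X).
Local Notation w := (winf X).
Local Notation r := (toKinf X \o const X).

Let w_val : normalized_valuation w := completion_valuation (KinfP X).
Let v_val : normalized_valuation v := point_valuation (vinfP X).

Lemma winf_toKinf x : x != 0 -> w (j x) = v x.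
Proof. exact: completion_extends (KinfP X) x. Qed.

Lemma vge_toKinf m x : vge w m (j x) = vge v m x.
Proof.
have [->|x_neq0] := eqVneq x 0; first by rewrite rmorph0 !vge0.
by rewrite !vgeE ?fmorph_eq0 // winf_toKinf.
Qed.

Lemma vge_const c : vge v 0 (const X c).
Proof.
have [->|c_neq0] := eqVneq c 0; first by rewrite rmorph0 vge0.
by rewrite vgeE ?fmorph_eq0 // (point_const (vinfP X)).
Qed.

Lemma winf_const c : c != 0 -> w (r c) = 0.
Proof.
move=> c_neq0; rewrite /= winf_toKinf ?fmorph_eq0 //.
exact: point_const (vinfP X) c c_neq0.
Qed.

Let pi_neq0 : unif X != 0 := (unifP X).1.

Lemma winf_unif (n : int) : w (unif X ^ n) = n.
Proof. by rewrite valuationXz // (unifP X).2 mul1r. Qed.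

Lemma winf_monomial c n : c != 0 -> w (r c * unif X ^ n) = n.
Proof.
move=> c_neq0; rewrite (valuationM w_val) ?expfz_neq0 ?fmorph_eq0 //.
by rewrite winf_const // winf_unif add0r.
Qed.

Lemma vge_monomial c n : vge w n (r c * unif X ^ n).
Proof.
have [->|c_neq0] := eqVneq c 0; first by rewrite rmorph0 mul0r vge0.
by rewrite /vge winf_monomial // lexx orbT.
Qed.

(** Divide by [unif X ^ n], approximate the quotient by an element of [K] (density), and reduce that
    element to a constant, the point being rational. *)
Lemma exists_leading_coef (n : int) x : vge w n x ->
  exists c, vge w (n + 1) (x - r c * unif X ^ n).
Proof.
move=> nx; have nz : unif X ^ n != 0 by rewrite expfz_neq0.
have x'0 : vge w 0 (x * unif X ^ (- n)).
  by rewrite -(subrr n) vgeM // /vge winf_unif lexx orbT.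
have [y xy] := completion_dense (KinfP X) (x * unif X ^ (- n)) 1.
have y0 : vge v 0 y.
  rewrite -vge_toKinf -(subKr (x * unif X ^ (- n)) (j y)) vgeB //.
  exact: vge_le xy.
have [c yc] := point_rational (vinfP X) y0; exists c.
have -> : x - r c * unif X ^ n = unif X ^ n * (x * unif X ^ (- n) - r c).
  by rewrite mulrBr mulrCA -expfzDr // subrr expr0z mulr1 mulrC [_ * r c]mulrC.
rewrite vgeM //; first by rewrite /vge winf_unif lexx orbT.
rewrite -(subrK (j y) (x * _)) -addrA vgeD //.
by rewrite /= -rmorphB vge_toKinf.
Qed.

Lemma expansion_lead x n c : is_expansion x n c ->
  vge w (n + 1) (x - r (c 0%N) * unif X ^ n).
Proof.
(* The index [M.+1] ensures that the partial sum contains the term of index 0. *)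
case=> c0 /(_ (n + 1)) [M /(_ M.+1 (leqnSn M))].
rewrite big_ord_recl /= addr0; set rest := \sum_(_ < _) _ => lim.
have restP : vge w (n + 1) rest.
  rewrite /rest; elim/big_ind: _ => [|y z|i _]; [exact: vge0 | exact: vgeD |].
  by apply: vge_le (vge_monomial _ _); rewrite lerD2l.
by rewrite -vgeN // opprB -[_ - x](addrK rest) vgeB // addrAC.
Qed.

(** Successive approximation: [rem m] is what is left of [x] after removing [m] terms, and [lc]
    chooses the next coefficient so that the valuation bound rises by one. *)
Lemma exists_expansion x : x != 0 -> exists c, is_expansion x (w x) c.
Proof.
move=> x_neq0; set n := w x.
pose LC y (m : nat) : set k :=
  [set c | vge w (n + m%:Z + 1) (y - r c * unif X ^ (n + m%:Z))]%classic.
pose lc y m := xget 0 (LC y m).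
have lcP y (m : nat) : vge w (n + m%:Z) y ->
    vge w (n + m%:Z + 1) (y - r (lc y m) * unif X ^ (n + m%:Z)).
  move=> /exists_leading_coef[c cP].
  by apply: (@xgetPex _ 0 (LC y m)); exists c.
pose rem := fix rem m := if m is m'.+1 then
  rem m' - r (lc (rem m') m') * unif X ^ (n + m'%:Z) else x.
have remP m : vge w (n + m%:Z) (rem m).
  elim: m => [|m IHm]; first by rewrite addr0 vge_refl.
  by have := lcP _ _ IHm; rewrite -addrA -PoszD addn1.
pose c m := lc (rem m) m; exists c; split.
  apply/eqP => c0; have := lcP x 0%N; rewrite addr0 vge_refl => /(_ isT).
  by rewrite -/(c 0%N) c0 rmorph0 mul0r subr0 vgeE // -/n; lia.
have remE m :
    \sum_(i < m) j (const X (c i)) * unif X ^ (n + i%:Z) - x = - rem m.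
  elim: m => [|m IHm]; first by rewrite big_ord0 sub0r.
  by rewrite big_ord_recr /= addrAC IHm opprB addrC.
move=> m; exists `|m - n|%N => p le_p; rewrite remE vgeN //.
apply: vge_le (remP p); lia.
Qed.

Lemma sgn_spec x : x != 0 ->
  sgn x != 0 /\ vge w (w x + 1) (x - r (sgn x) * unif X ^ (w x)).
Proof.
move=> x_neq0; have [c xc] := exists_expansion x_neq0.
(* The expansion selected by [sgn] starts at some exponent [n], a priori unrelated to [w x]; its
   nonzero leading monomial then forces [n = w x]. *)
have [n [d [xd sx]]] : exists n d, is_expansion x n d /\ sgn x = d 0%N.
  rewrite /sgn; set S := (X in xget _ X).
  by have := @xgetPex _ 0 S; apply; exists (c 0%N), (w x), c.
have [d0 _] := xd; have := expansion_lead xd; rewrite -sx in d0 * => lead.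
split=> //.
have [|_ ->//] := vge_valuation_eq w_val _ (winf_monomial n d0) lead.
by rewrite mulf_neq0 ?expfz_neq0 // fmorph_eq0.
Qed.

(** An element with an expansion has the valuation of its leading monomial and is nonzero, so for 0
    [xget] returns its default value. *)
Lemma sgn0 : sgn (0 : Kinf X) = 0.
Proof.
apply: xgetPN => s [n [c [c_exp _]]]; have [c0 _] := c_exp.
have := vge_valuation_eq w_val _ (winf_monomial n c0) (expansion_lead c_exp).
by rewrite mulf_neq0 ?expfz_neq0 ?fmorph_eq0 // eqxx => /(_ isT) [].
Qed.

(** If [s] and [sgn x] differed, their difference times [unif X ^ n] would have valuation exactly
    [n], yet both approximations force at least [n + 1]. *)
Lemma sgn_unique x n s : s != 0 -> vge w (n + 1) (x - r s * unif X ^ n) ->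
  [/\ x != 0, w x = n & sgn x = s].
Proof.
move=> s_neq0 xs; have sp_neq0 : r s * unif X ^ n != 0.
  by rewrite mulf_neq0 ?expfz_neq0 ?fmorph_eq0.
have [x_neq0 wx] := vge_valuation_eq w_val sp_neq0 (winf_monomial n s_neq0) xs.
split=> //; have [t_neq0] := sgn_spec x_neq0; rewrite wx => xt.
apply/eqP; apply: contraT; rewrite -subr_eq0 => ts.
have := vgeB w_val xs xt; rewrite opprB [x - _ + _]addrC addrA subrK.
rewrite -mulrBl -rmorphB.
rewrite vgeE ?mulf_neq0 ?expfz_neq0 ?fmorph_eq0 // winf_monomial //; lia.
Qed.

Lemma sgnZ c x : sgn (r c * x) = c * sgn x.
Proof.
have [->|c_neq0] := eqVneq c 0; first by rewrite rmorph0 !mul0r sgn0.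
have [->|x_neq0] := eqVneq x 0; first by rewrite mulr0 sgn0 mulr0.
have [s_neq0 lead] := sgn_spec x_neq0.
have [//||_ _ //] := @sgn_unique (r c * x) (w x) (c * sgn x).
  by rewrite mulf_neq0.
rewrite rmorphM /= -mulrA -mulrBr -[_ + 1]add0r vgeM //.
by rewrite vge_toKinf vge_const.
Qed.

Lemma sgn_add x y : x != 0 -> vge w (w x + 1) y ->
  [/\ x + y != 0, w (x + y) = w x & sgn (x + y) = sgn x].
Proof.
move=> x_neq0 y_ge; have [s_neq0 lead] := sgn_spec x_neq0.
by apply: sgn_unique s_neq0 _; rewrite addrAC vgeD.
Qed.

Lemma vge_sub_sgn_eq x y : x != 0 -> y != 0 -> w x = w y -> sgn x = sgn y ->
  vge w (w x + 1) (x - y).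
Proof.
move=> x_neq0 y_neq0 wxy sxy; have [_ xs] := sgn_spec x_neq0.
have [_] := sgn_spec y_neq0; rewrite -wxy -sxy => ys.
by have := vgeB w_val xs ys; rewrite opprB addrA subrK.
Qed.


End LeadingCoefficient.

(** * Monic elements of [A] and the identity on the curve *)

Section Curve.
Variables (k : finFieldType) (X : pointed_curve k).
Local Notation q := #|k|.
Local Notation A := (regfun X).
Local Notation j := (toKinf X).
Local Notation v := (vinf X).
Local Notation w := (winf X).
Local Notation h := (@regfun_const k X).
Local Notation sg a := (sgn (toKinf X (val (a : regfun X)))).

Let v_val : normalized_valuation v := point_valuation (vinfP X).

Lemma AplusP d (a : A) :
  Aplus X d a <-> [/\ a != 0, v (val a) = - d%:Z & sg a = 1].
Proof.
split=> [[sa da]|[a_neq0 va sa]]; last by split=> //; rewrite /deg va opprK.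
split=> //; last by rewrite -da opprK.
apply/eqP => a0; move: sa; rewrite a0 !rmorph0 sgn0 => /esym/eqP.
by rewrite oner_eq0.
Qed.

Lemma sgZ c (a : A) : sg (h c * a) = c * sg a.
Proof. by rewrite -(sgnZ c) /= rmorphM. Qed.

Lemma sg_eq0 (a : A) : sg a = 0 -> a = 0.
Proof.
move=> sa; apply/eqP; apply: contraT => a_neq0.
have /sgn_spec[] : j (val a) != 0 by rewrite !fmorph_eq0.
by rewrite sa eqxx.
Qed.

Lemma vge_regfunZ m c (a : A) : vge v m (val a) -> vge v m (val (h c * a)).
Proof.
by move=> ma; rewrite rmorphM /= -[m]add0r vgeM // vge_const.
Qed.

(* If [deg a < 0], the powers [a ^+ n.+1] are distinct elements of the set. *)
Lemma vinf_le0 i (a : A) :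
  finite_set [set b : A | vge v (1 - i%:Z) (val b)]%classic -> a != 0 ->
  v (val a) <= 0.
Proof.
move=> W_fin a_neq0; rewrite leNgt; apply/negP => va_gt0.
have va_neq0 : val a != 0 by [].
have vaX n : v (val (a ^+ n)) = v (val a) * n%:Z.
  by rewrite rmorphXn valuationX // -mulr_natr natz.
have aX_inj : injective (fun n : nat => a ^+ n.+1).
  move=> m n /(congr1 (fun b : A => v (val b))); rewrite !vaX.
  move/(mulfI (lt0r_neq0 va_gt0)); lia.
apply: infinite_nat.
have := @finite_preimage _ _ _ (fun n : nat => a ^+ n.+1) (in2W aX_inj) W_fin.
apply: sub_finite_set => n _ /=.
have an_neq0 : val (a ^+ n.+1) != 0 by rewrite rmorphXn expf_neq0.
by rewrite vgeE // vaX; nia.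
Qed.

(** Equal degree and sign mean equal leading terms, which cancel in [a - a0]; conversely, adding an
    element of degree [< i] keeps the leading term of [a0]. *)
Lemma Aplus_translate i (a0 a : A) : Aplus X i a0 ->
  Aplus X i a <-> vge v (1 - i%:Z) (val (a - a0)).
Proof.
move=> /AplusP[a0_neq0 va0 sa0].
have ja0_neq0 : j (val a0) != 0 by rewrite !fmorph_eq0.
have wa0 : w (j (val a0)) = - i%:Z by rewrite winf_toKinf.
have mE : 1 - i%:Z = w (j (val a0)) + 1 by rewrite wa0 addrC.
split=> [/AplusP[a_neq0 va sa]|].
  have ja_neq0 : j (val a) != 0 by rewrite !fmorph_eq0.
  rewrite -vge_toKinf !rmorphB /= mE.
  have wa : w (j (val a)) = w (j (val a0)) by rewrite wa0 winf_toKinf.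
  by rewrite -wa vge_sub_sgn_eq // sa sa0.
rewrite -vge_toKinf mE => /(sgn_add ja0_neq0).
rewrite -!rmorphD /= addrC subrK => -[ja_neq0 wa s_a].
have a_neq0 : a != 0 by apply: contraNneq ja_neq0 => ->; rewrite !rmorph0.
by apply/AplusP; split=> //; rewrite ?s_a // -winf_toKinf // wa.
Qed.

(** In degree exactly [i], take [c = sg a]: then [c^-1 * a] and [a0] are both monic and
    [Aplus_translate] applies. In lower degree, take [c = 0]. *)
Lemma sub_lead i (a0 a : A) : Aplus X i a0 -> vge v (- i%:Z) (val a) ->
  exists c, vge v (1 - i%:Z) (val (a - h c * a0)).
Proof.
move=> a0_mon a_ge; have [va|va_neq] := eqVneq (v (val a)) (- i%:Z); last first.
  exists 0; rewrite rmorph0 mul0r subr0; move: (val a) va_neq a_ge => z.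
  by rewrite /vge; case: (z == 0) => //=; lia.
have [->|a_neq0] := eqVneq a 0.
  by exists 0; rewrite rmorph0 mul0r subr0 rmorph0 vge0.
have sa_neq0 : sg a != 0 by apply: contra_neq a_neq0; apply: sg_eq0.
exists (sg a); have: Aplus X i (h (sg a)^-1 * a).
  apply/AplusP; split; last by rewrite sgZ mulVf.
    apply/eqP => /(congr1 (fun b => h (sg a) * b)) /eqP.
    by rewrite mulrA -rmorphM mulfV // rmorph1 mul1r mulr0 (negPf a_neq0).
  rewrite rmorphM (valuationM v_val) ?fmorph_eq0 ?invr_eq0 //=.
  by rewrite (point_const (vinfP X)) ?invr_eq0 // add0r.
move/(Aplus_translate _ a0_mon)/(vge_regfunZ (sg a)).
by rewrite mulrBr mulrA -rmorphM mulfV // rmorph1 mul1r.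
Qed.

Lemma twist_sum (I : finType) (P : pred I) (F : I -> AtensK X) :
  twist (\sum_(x | P x) F x) = \sum_(x | P x) twist (F x).
Proof. exact: (big_morph _ (@twistD k X) (@twist0 k X)). Qed.

Let main_identity i :=
  twist (calS X i) = calS_le X i * (1 \ox powS X i (q - 1)) /\
  \sum_(a \in Aplus X i) a \ox (val a) ^- q =
    (\sum_(0 <= l < i.+1) \sum_(b \in Aplus X l) b \ox (val b)^-1) *
    (1 \ox \sum_(a \in Aplus X i) (val a) ^- (q - 1)).

(** Serves for both an empty and an infinite [A_{+,i}]. Restricting to families without zero terms
    suffices: inverse powers of monic elements are nonzero, and so are the pure tensors, by
    [tens_eq0]. *)
Lemma identity_of_sums_eq0 i :
  (forall (V : zmodType) (F : A -> V), (forall a, Aplus X i a -> F a != 0) ->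
    \sum_(a \in Aplus X i) F a = 0) ->
  main_identity i.
Proof.
have tens_neq0 (a : A) (e : funfield X) : a != 0 -> e != 0 -> a \ox e != 0.
  move=> a_neq0 e_neq0.
  apply/eqP => /(@tens_eq0 _ _ h _ val (const X) _ _ (fun c => erefl))/eqP.
  by apply/negP; rewrite mulf_neq0.
move=> sum0; have inv_neq0 (a : A) n : Aplus X i a -> (val a) ^- n != 0.
  by move=> /AplusP[a_neq0 _ _]; rewrite invr_eq0 expf_neq0.
have pow0 : \sum_(a \in Aplus X i) (val a) ^- (q - 1) = 0.
  by apply: sum0 => a /inv_neq0.
have pure0 : (1 : A) \ox 0 = 0 by apply: tensr0.
rewrite /main_identity /powS pow0 pure0 !mulr0; split.
  rewrite /calS sum0 ?twist0 // => a Aa; have /AplusP[a_neq0 _ _] := Aa.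
  by rewrite tens_neq0 // -[val a]expr1 inv_neq0.
apply: sum0 => a Aa; have /AplusP[a_neq0 _ _] := Aa.
by rewrite tens_neq0 ?inv_neq0.
Qed.

Lemma identity_of_finite i a0 :
  finite_set (Aplus X i) -> Aplus X i a0 -> main_identity i.
Proof.
move=> Ai_fin a0_mon; have /AplusP[a0_neq0 va0 sa0] := a0_mon.
pose W := [set b : A | vge v (1 - i%:Z) (val b)]%classic.
have W_fin : finite_set W.
  have := finite_preimage (in2W (addrI a0)) Ai_fin; apply: sub_finite_set.
  move=> b Wb /=; apply/(Aplus_translate _ a0_mon).
  by rewrite [a0 + b]addrC addrK.
have [||m [b [b_inj WE]]] := @finite_basis _ _ h W W_fin.
- exact: vge0.
- by move=> c a a' Wa Wa'; apply: (vgeD v_val (vge_regfunZ c Wa) Wa').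
pose be := fcons a0 b.
have be_inj : injective (comb h be).
  apply: comb_fcons_inj => // x xa0; have : W a0 by apply/WE; exists x.
  by rewrite /W /= vgeE // va0; lia.
have val_be_inj : injective (val \o comb h be).
  exact: inj_comp val_inj be_inj.
have AiE a : Aplus X i a <-> exists x, a0 + comb h b x = a.
  apply: (iff_trans (Aplus_translate _ a0_mon)); apply: (iff_trans (WE _)).
  split=> -[x xa]; exists x; first by rewrite xa addrC subrK.
  by rewrite -xa addrC addKr.
have sumAi (V : zmodType) (F : A -> V) :
    \sum_(a \in Aplus X i) F a = \sum_x F (a0 + comb h b x).
  rewrite (fsbig_inj_finType (u := fun x => a0 + comb h b x)).
  - by apply: eq_bigl => x; apply/asboolP/AiE; exists x.
  - by move=> x y /addrI/b_inj.
  by move=> a /AiE.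
(* With [v_be], this identifies the span of [be] with the elements of degree at most [i], so it
   contains [A_{+,l}] for every [l <= i]. *)
have VE a : vge v (- i%:Z) (val a) -> exists x, comb h be x = a.
  case/(sub_lead a0_mon) => c /WE[x xa]; exists (row_cons c x).
  by rewrite comb_fcons xa addrC subrK.
have v_be x : vge v (- i%:Z) (val (comb h be x)).
  rewrite [x]row_consK comb_fcons rmorphD vgeD //.
    by rewrite vge_regfunZ // vgeE // va0.
  by apply: (@vge_le _ _ _ (1 - i%:Z)); [lia | apply/WE; eexists].
have calS_leE : calS_le X i =
    \sum_(x | sg (comb h be x) == 1) comb h be x \ox (val (comb h be x))^-1.
  (* [p x] is the degree of [comb be x]. On nonzero vectors [inord] loses nothing, since [v_be] and
     [vinf_le0] place the valuation between [- i] and 0. *)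
  pose p (x : 'rV[k]_m.+1) : 'I_i.+1 := inord `|v (val (comb h be x))|%N.
  rewrite /calS_le big_mkord [RHS](partition_big p predT) //=.
  apply: eq_bigr => l _.
  rewrite /calS (fsbig_inj_finType _ be_inj) => [|a /AplusP[a_neq0 va _]].
    apply: eq_bigl => x.
    apply/asboolP/andP => [/AplusP[_ vx sx]|[/eqP sx /eqP px]].
      rewrite sx eqxx; split=> //; apply/eqP/val_inj.
      rewrite /p vx abszN absz_nat.
      by rewrite /= inordK.
    have x_neq0 : comb h be x != 0.
      apply: contra_eq_neq sx => ->.
      by rewrite !rmorph0 sgn0 eq_sym oner_neq0.
    apply/AplusP; split=> //; have vx_le0 := vinf_le0 W_fin x_neq0.
    have := v_be x; rewrite vgeE // => vx_ge.
    move: px => /(congr1 (@nat_of_ord _)).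
    rewrite /p; move: (v _) vx_le0 vx_ge => z z_le0 z_ge.
    by rewrite inordK; lia.
  by apply: VE; rewrite vgeE // va lerN2 lez_nat -ltnS.
suff main : \sum_(a \in Aplus X i) a \ox (val a) ^- q =
    calS_le X i * (1 \ox powS X i (q - 1)).
  split; last exact: main.
  rewrite -main /calS !sumAi twist_sum; apply: eq_bigr => x _.
  by rewrite twist_pure exprVn.
rewrite calS_leE /powS !sumAi.
have fhE c : val (h c) = const X c by [].
rewrite (moore_tensor_identity fhE val_be_inj).
(* The sum over the whole span is [q.-1] times the sum [T] over monic vectors, and [T *+ q = 0]
   gives [- (T *+ q.-1) = T]. *)
rewrite (sum_monic (sg := fun x => sg (comb h be x))).
- rewrite -mulNr; congr (_ * _); set T := (X in - (X *+ _)).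
  apply: (addIr (T *+ q.-1)); rewrite addNr -mulrS prednK.
    by rewrite (tensor_char val).
  exact: ltnW (finRing_gt1 k).
- by move=> c x; rewrite combZ sgZ.
- by move=> x /sg_eq0 x0; apply: be_inj; rewrite raddf0.
- by rewrite raddf0 rmorph0 invr0 tensr0.
move=> c x c_neq0; rewrite combZ rmorphM invfM tensZ.
by rewrite mulrA mulfV ?mul1r ?fmorph_eq0.
Qed.
End Curve.

Theorem theorem2p4 (k : finFieldType) (X : pointed_curve k) (i : nat) :
  twist (calS X i) = calS_le X i * (1 \ox powS X i (#|k| - 1)) /\
  \sum_(a \in Aplus X i) a \ox (val a) ^- #|k| =
    (\sum_(0 <= l < i.+1) \sum_(b \in Aplus X l) b \ox (val b)^-1) *
    (1 \ox \sum_(a \in Aplus X i) (val a) ^- (#|k| - 1)).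
Proof.
have [[a0 a0_mon] | Ai0] := pselect (exists a0, Aplus X i a0); last first.
  apply: identity_of_sums_eq0 => V F _; apply: fsbig1 => a Aa.
  by case: Ai0; exists a.
have [Ai_fin | Ai_inf] := pselect (finite_set (Aplus X i)).
  exact: identity_of_finite a0_mon.
(* All terms being nonzero, the support is the whole infinite set and the sum takes its default
   value 0. *)
apply: identity_of_sums_eq0 => V F F_neq0; apply: fsbig_dflt.
apply: contra_not Ai_inf; apply: sub_finite_set => a Aa; split=> //=.
exact/eqP/F_neq0.
Qed.
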